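(* Let $R$ be a nonzero commutative ring with identity, and let $G$ be a finite simple graph with vertex set $X=\{x_1,\dots,x_n\}$. Then the set $\mathfrak{B}(X;G)$ (defined in the context) is a basis, as an $R$-module, of the partially commutative metabelian Lie algebra $M(X;G)$ over $R$.
   Context: $M(X)$ is the free metabelian Lie $R$-algebra on $X$ (metabelian: $[[a,b],[c,d]]=0$ identically), and $M(X;G)$ is its quotient by the ideal generated by all $[x_i,x_j]$ with $\{x_i,x_j\}$ an edge of $G$. Write $[a_1,a_2,\dots,a_m]=[\dots[[a_1,a_2],a_3],\dots,a_m]$ for left-normed products. Order $X$ by $x_1<x_2<\dots<x_n$. The multidegree of a Lie monomial is the vector $\overline{\delta}=(\delta_1,\dots,\delta_n)$ where $\delta_i$ is the number of occurrences of $x_i$. For a monomial $u$, $G_u$ is the subgraph of $G$ induced on the set of generators occurring in $u$; it depends only on the multidegree. For a multidegree $\overline{\delta}$ with $\sum_i\delta_i\geqslant 2$, let $B'_{\overline{\delta}}(X)$ be the set of monomials $[x_{i_1},x_{i_2},\dots,x_{i_m}]$ of multidegree $\overline\delta$ with $m\geqslant 2$, $x_{i_2}<x_{i_1}$ and $x_{i_2}\leqslant x_{i_3}\leqslant\dots\leqslant x_{i_m}$. Let $B''_{\overline{\delta}}(X;G)$ be obtained from it by removing all monomials $u=[x_{i_1},x_{i_2},\dots,x_{i_m}]$ that are equal to zero in $M(X;G)$; equivalently, those for which $x_{i_1}$ and $x_{i_2}$ lie in the same connected component of $G_u$. On $B''_{\overline{\delta}}(X;G)$ set $u_1\sim u_2$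 if the first letters of $u_1$ and $u_2$ lie in the same connected component of $G_{u_1}=G_{u_2}$; this is an equivalence relation. Let $B_{\overline{\delta}}(X;G)$ consist of one element of each equivalence class, namely the one whose first letter is the largest among the first letters of the monomials of the class. If $\sum_i\delta_i=1$, let $B_{\overline{\delta}}(X;G)$ consist of the single generator of multidegree $\overline{\delta}$. Put $\mathfrak{B}(X;G)=\bigcup_{\overline{\delta}}B_{\overline{\delta}}(X;G)$, the union over all multidegrees. *)

(* Defs.v *)
From HB Require Import structures.
From mathcomp Require Import all_boot all_algebra.
From mathcomp Require Import boolp classical_sets.

Set Implicit Arguments.
Unset Strict Implicit.
Unset Printing Implicit Defensive.

Import GRing.Theory.

Local Open Scope ring_scope.
Local Open Scope quotient_scope.

HB.mixin Record Lmodule_isLie (R : comPzRingType) L of GRing.Lmodule R L := {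
  lie : L -> L -> L;
  lieDl : forall a b c, lie (a + b) c = lie a c + lie b c;
  lieDr : forall a b c, lie a (b + c) = lie a b + lie a c;
  lieZl : forall k a b, lie (k *: a) b = k *: lie a b;
  lieZr : forall k a b, lie a (k *: b) = k *: lie a b;
  liexx : forall a, lie a a = 0;
  lie_jacobi : forall a b c,
    lie (lie a b) c + lie (lie b c) a + lie (lie c a) b = 0
}.

#[short(type="lieAlgType")]
HB.structure Definition LieAlgebra (R : comPzRingType) :=
  {L of GRing.Lmodule R L & Lmodule_isLie R L}.

Definition metabelian (R : comPzRingType) (L : lieAlgType R) : Prop :=
  forall a b c d : L, lie (lie a b) (lie c d) = 0.

Definition lie_hom (R : comPzRingType) (L L' : lieAlgType R) (g : L -> L') :
    Prop :=
  linear g /\ {morph g : a b / lie a b}.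

(* As for any variety of algebras, the free object is the algebra of terms
   modulo the least congruence containing the identities of the variety; see
   free_metab_lift and free_metab_lift_uniq for its universal property. *)
Section FreeMetabelian.
Variables (R : comPzRingType) (X : Type).

Inductive lterm : Type :=
| LVar of X
| LZero
| LOpp of lterm
| LAdd of lterm & lterm
| LScale of R & lterm
| LLie of lterm & lterm.

HB.instance Definition _ := gen_eqMixin lterm.
HB.instance Definition _ := gen_choiceMixin lterm.

Inductive lcong : lterm -> lterm -> Prop :=
| lcong_refl t : lcong t t
| lcong_sym t u : lcong t u -> lcong u t
| lcong_trans t u v : lcong t u -> lcong u v -> lcong t v
| lcong_opp t t' : lcong t t' -> lcong (LOpp t) (LOpp t')
| lcong_add t t' u u' :
    lcong t t' -> lcong u u' -> lcong (LAdd t u) (LAdd t' u')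
| lcong_scale k t t' : lcong t t' -> lcong (LScale k t) (LScale k t')
| lcong_lie t t' u u' :
    lcong t t' -> lcong u u' -> lcong (LLie t u) (LLie t' u')
| lcong_addA t u v : lcong (LAdd t (LAdd u v)) (LAdd (LAdd t u) v)
| lcong_addC t u : lcong (LAdd t u) (LAdd u t)
| lcong_add0 t : lcong (LAdd LZero t) t
| lcong_addN t : lcong (LAdd (LOpp t) t) LZero
| lcong_scaleA k l t : lcong (LScale k (LScale l t)) (LScale (k * l) t)
| lcong_scale1 t : lcong (LScale 1 t) t
| lcong_scaleDr k t u :
    lcong (LScale k (LAdd t u)) (LAdd (LScale k t) (LScale k u))
| lcong_scaleDl k l t :
    lcong (LScale (k + l) t) (LAdd (LScale k t) (LScale l t))
| lcong_lieDl t u v :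
    lcong (LLie (LAdd t u) v) (LAdd (LLie t v) (LLie u v))
| lcong_lieDr t u v :
    lcong (LLie t (LAdd u v)) (LAdd (LLie t u) (LLie t v))
| lcong_lieZl k t u : lcong (LLie (LScale k t) u) (LScale k (LLie t u))
| lcong_lieZr k t u : lcong (LLie t (LScale k u)) (LScale k (LLie t u))
| lcong_liexx t : lcong (LLie t t) LZero
| lcong_jacobi t u v :
    lcong (LAdd (LAdd (LLie (LLie t u) v) (LLie (LLie u v) t))
                (LLie (LLie v t) u)) LZero
| lcong_metab t u v w : lcong (LLie (LLie t u) (LLie v w)) LZero.

Definition lcongb (t u : lterm) : bool := `[< lcong t u >].

Lemma lcongb_equiv : equiv_class_of lcongb.
Proof.
split=> [t|t u|u t v].
- exact/asboolP/lcong_refl.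
- by apply/asboolP/asboolP; exact: lcong_sym.
- move=> /asboolP tu /asboolP uv; apply/asboolP.
  exact: lcong_trans tu uv.
Qed.

Canonical lcongb_equivRel := EquivRelPack lcongb_equiv.
Canonical lcongb_encModRel := defaultEncModRel lcongb.

Definition free_metab : Type := {eq_quot lcongb}.
HB.instance Definition _ := Choice.on free_metab.
HB.instance Definition _ := EqQuotient.on free_metab.

Definition fm_class (t : lterm) : free_metab := \pi_{eq_quot lcongb} t.

Lemma fm_classP t u : fm_class t = fm_class u <-> lcong t u.
Proof.
split=> [/eqmodP/asboolP // | tu].
by apply/eqmodP/asboolP.
Qed.

Lemma fm_reprK (a : free_metab) : fm_class (repr a) = a.
Proof. exact: reprK. Qed.

Lemma fm_repr_class t : lcong (repr (fm_class t)) t.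
Proof. by apply/fm_classP; rewrite fm_reprK. Qed.

Definition fm_gen (x : X) : free_metab := fm_class (LVar x).
Definition fm_zero : free_metab := fm_class LZero.
Definition fm_opp (a : free_metab) : free_metab := fm_class (LOpp (repr a)).
Definition fm_add (a b : free_metab) : free_metab :=
  fm_class (LAdd (repr a) (repr b)).
Definition fm_scale (k : R) (a : free_metab) : free_metab :=
  fm_class (LScale k (repr a)).
Definition fm_lie (a b : free_metab) : free_metab :=
  fm_class (LLie (repr a) (repr b)).

Lemma fm_oppE t : fm_opp (fm_class t) = fm_class (LOpp t).
Proof. apply/fm_classP/lcong_opp; exact: fm_repr_class. Qed.
Lemma fm_addE t u : fm_add (fm_class t) (fm_class u) = fm_class (LAdd t u).
Proof. apply/fm_classP/lcong_add; exact: fm_repr_class. Qed.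
Lemma fm_scaleE k t : fm_scale k (fm_class t) = fm_class (LScale k t).
Proof. apply/fm_classP/lcong_scale; exact: fm_repr_class. Qed.
Lemma fm_lieE t u : fm_lie (fm_class t) (fm_class u) = fm_class (LLie t u).
Proof. apply/fm_classP/lcong_lie; exact: fm_repr_class. Qed.

Definition fmE := (fm_oppE, fm_addE, fm_scaleE, fm_lieE).

Lemma fm_ind (P : free_metab -> Prop) :
  (forall t, P (fm_class t)) -> forall a, P a.
Proof. by move=> Pt a; rewrite -(fm_reprK a). Qed.

Fact fm_addA : associative fm_add.
Proof.
elim/fm_ind=> t; elim/fm_ind=> u; elim/fm_ind=> v; rewrite !fmE.
exact/fm_classP/lcong_addA.
Qed.
Fact fm_addC : commutative fm_add.
Proof.
elim/fm_ind=> t; elim/fm_ind=> u; rewrite !fmE; exact/fm_classP/lcong_addC.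
Qed.
Fact fm_add0 : left_id fm_zero fm_add.
Proof. elim/fm_ind=> t; rewrite !fmE; exact/fm_classP/lcong_add0. Qed.
Fact fm_addN : left_inverse fm_zero fm_opp fm_add.
Proof. elim/fm_ind=> t; rewrite !fmE; exact/fm_classP/lcong_addN. Qed.

HB.instance Definition _ :=
  GRing.isZmodule.Build free_metab fm_addA fm_addC fm_add0 fm_addN.

Fact fm_scaleA k l a : fm_scale k (fm_scale l a) = fm_scale (k * l) a.
Proof.
by elim/fm_ind: a => t; rewrite !fmE; exact/fm_classP/lcong_scaleA.
Qed.
Fact fm_scale1 : left_id 1 fm_scale.
Proof. elim/fm_ind=> t; rewrite !fmE; exact/fm_classP/lcong_scale1. Qed.
Fact fm_scaleDr : right_distributive fm_scale +%R.
Proof.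
move=> k; elim/fm_ind=> t; elim/fm_ind=> u.
rewrite -[RHS]/(fm_add _ _) -[_ + _]/(fm_add _ _) !fmE.
exact/fm_classP/lcong_scaleDr.
Qed.
Fact fm_scaleDl a : {morph fm_scale^~ a : k l / k + l}.
Proof.
move=> k l; elim/fm_ind: a => t.
rewrite -[RHS]/(fm_add _ _) !fmE.
exact/fm_classP/lcong_scaleDl.
Qed.

HB.instance Definition _ := GRing.Zmodule_isLmodule.Build R free_metab
  fm_scaleA fm_scale1 fm_scaleDr fm_scaleDl.

Lemma fm_class0 : fm_class LZero = 0. Proof. by []. Qed.
Lemma fm_classN t : fm_class (LOpp t) = - fm_class t.
Proof. by rewrite -fmE. Qed.
Lemma fm_classD t u : fm_class (LAdd t u) = fm_class t + fm_class u.
Proof. by rewrite -[LHS]fm_addE. Qed.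
Lemma fm_classZ k t : fm_class (LScale k t) = k *: fm_class t.
Proof. by rewrite -fm_scaleE. Qed.

Fact fm_lieDl a b c : fm_lie (a + b) c = fm_lie a c + fm_lie b c.
Proof.
elim/fm_ind: a => t; elim/fm_ind: b => u; elim/fm_ind: c => v.
rewrite -fm_classD !fm_lieE -fm_classD; exact/fm_classP/lcong_lieDl.
Qed.
Fact fm_lieDr a b c : fm_lie a (b + c) = fm_lie a b + fm_lie a c.
Proof.
elim/fm_ind: a => t; elim/fm_ind: b => u; elim/fm_ind: c => v.
rewrite -fm_classD !fm_lieE -fm_classD; exact/fm_classP/lcong_lieDr.
Qed.
Fact fm_lieZl k a b : fm_lie (k *: a) b = k *: fm_lie a b.
Proof.
elim/fm_ind: a => t; elim/fm_ind: b => u.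
rewrite -fm_classZ !fm_lieE -fm_classZ; exact/fm_classP/lcong_lieZl.
Qed.
Fact fm_lieZr k a b : fm_lie a (k *: b) = k *: fm_lie a b.
Proof.
elim/fm_ind: a => t; elim/fm_ind: b => u.
rewrite -fm_classZ !fm_lieE -fm_classZ; exact/fm_classP/lcong_lieZr.
Qed.
Fact fm_liexx a : fm_lie a a = 0.
Proof.
by elim/fm_ind: a => t; rewrite fm_lieE; exact/fm_classP/lcong_liexx.
Qed.
Fact fm_jacobi a b c :
  fm_lie (fm_lie a b) c + fm_lie (fm_lie b c) a + fm_lie (fm_lie c a) b = 0.
Proof.
elim/fm_ind: a => t; elim/fm_ind: b => u; elim/fm_ind: c => v.
rewrite !fm_lieE -!fm_classD; exact/fm_classP/lcong_jacobi.
Qed.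

HB.instance Definition _ := Lmodule_isLie.Build R free_metab
  fm_lieDl fm_lieDr fm_lieZl fm_lieZr fm_liexx fm_jacobi.

Lemma fm_classL t u : fm_class (LLie t u) = lie (fm_class t) (fm_class u).
Proof. by rewrite -fm_lieE. Qed.

Lemma free_metabP : metabelian free_metab.
Proof.
move=> a b c d.
elim/fm_ind: a => t; elim/fm_ind: b => u.
elim/fm_ind: c => v; elim/fm_ind: d => w.
rewrite -!fm_classL; exact/fm_classP/lcong_metab.
Qed.

Section Universal.
Variables (L : lieAlgType R) (f : X -> L).

Fixpoint leval (t : lterm) : L :=
  match t with
  | LVar x => f x
  | LZero => 0
  | LOpp t => - leval t
  | LAdd t u => leval t + leval u
  | LScale k t => k *: leval t
  | LLie t u => lie (leval t) (leval u)
  end.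

Lemma leval_cong : metabelian L -> forall t u, lcong t u -> leval t = leval u.
Proof.
move=> mL t u; elim=> //= {t u}.
- by move=> t u v _ -> _ ->.
- by move=> t t' _ ->.
- by move=> t t' u u' _ -> _ ->.
- by move=> k t t' _ ->.
- by move=> t t' u u' _ -> _ ->.
- by move=> t u v; rewrite addrA.
- by move=> t u; rewrite addrC.
- by move=> t; rewrite add0r.
- by move=> t; rewrite addNr.
- by move=> k l t; rewrite scalerA.
- by move=> t; rewrite scale1r.
- by move=> k t u; rewrite scalerDr.
- by move=> k l t; rewrite scalerDl.
- by move=> t u v; rewrite lieDl.
- by move=> t u v; rewrite lieDr.
- by move=> k t u; rewrite lieZl.
- by move=> k t u; rewrite lieZr.
- by move=> t; rewrite liexx.
- by move=> t u v; rewrite lie_jacobi.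
Qed.

Lemma free_metab_lift : metabelian L ->
  exists2 g : free_metab -> L, lie_hom g & forall x, g (fm_gen x) = f x.
Proof.
move=> mL; pose g (a : free_metab) := leval (repr a).
have gE t : g (fm_class t) = leval t.
  exact/(leval_cong mL)/fm_repr_class.
exists g => [|x]; last by rewrite /fm_gen gE.
split=> [k a b|a b]; elim/fm_ind: a => t; elim/fm_ind: b => u.
  by rewrite -fm_classZ -fm_classD !gE.
by rewrite -fm_classL !gE.
Qed.

Lemma free_metab_lift_uniq (g h : free_metab -> L) :
  lie_hom g -> lie_hom h -> (forall x, g (fm_gen x) = h (fm_gen x)) ->
  g =1 h.
Proof.
move=> [gl gm] [hl hm] gh.
have l0 (k : free_metab -> L) : linear k -> k 0 = 0.
  move=> kl; have := kl 1 0 0; rewrite !scale1r addr0.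
  by move=> /(congr1 (fun v => v - k 0)); rewrite addrK subrr => <-.
have lD (k : free_metab -> L) a b : linear k -> k (a + b) = k a + k b.
  by move=> kl; have := kl 1 a b; rewrite !scale1r.
have lZ (k : free_metab -> L) r a : linear k -> k (r *: a) = r *: k a.
  by move=> kl; have := kl r a 0; rewrite (l0 k kl) !addr0.
elim/fm_ind; elim=> [x||t IH|t IHt u IHu|r t IH|t IHt u IHu].
- exact: gh.
- by rewrite fm_class0 !l0.
- by rewrite fm_classN -scaleN1r !lZ // IH.
- by rewrite fm_classD !lD // IHt IHu.
- by rewrite fm_classZ !lZ // IH.
- by rewrite fm_classL gm hm IHt IHu.
Qed.

End Universal.
End FreeMetabelian.

Section LieQuotient.
Variables (R : comPzRingType) (L : lieAlgType R).

(* By antisymmetry of the bracket, left ideals are two-sided. *)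
Definition lie_ideal (I : set L) : Prop :=
  [/\ I 0, forall a b, I a -> I b -> I (a + b),
      forall k a, I a -> I (k *: a) & forall a b, I b -> I (lie a b)].

Definition lie_ideal_gen (S : set L) : {pred L} :=
  [pred v | `[< forall I : set L, lie_ideal I -> (S `<=` I)%classic -> I v >]].

Variable S : set L.

Lemma lie_ideal_genP : lie_ideal [set` lie_ideal_gen S].
Proof.
split=> /= [|a b /asboolP ha /asboolP hb|k a /asboolP ha|a b /asboolP hb];
  apply/asboolP => I hI SI; have [I0 ID IZ IL] := hI => //.
- by apply: ID; [apply: ha|apply: hb].
- by apply: IZ; apply: ha.
- by apply: IL; apply: hb.
Qed.

Lemma sub_lie_ideal_gen : (S `<=` [set` lie_ideal_gen S])%classic.
Proof. by move=> v Sv; apply/asboolP => I _; apply. Qed.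

Fact lie_ideal_gen_zmod : zmod_closed (lie_ideal_gen S).
Proof.
have [I0 ID IZ _] := lie_ideal_genP.
by split=> // a b Ia Ib; apply: ID; rewrite // -scaleN1r; apply: IZ.
Qed.

HB.instance Definition _ :=
  GRing.isZmodClosed.Build L (lie_ideal_gen S) lie_ideal_gen_zmod.

Definition lie_quot : Type := Quotient.quot (lie_ideal_gen S).
HB.instance Definition _ := GRing.Zmodule.on lie_quot.

Definition lie_proj (a : L) : lie_quot :=
  \pi_(Quotient.quot (lie_ideal_gen S)) a.

Lemma lie_projP a b : lie_proj a = lie_proj b <-> a - b \in lie_ideal_gen S.
Proof.
by rewrite Quotient.idealrBE; split=> [h|/eqP]; [apply/eqP|].
Qed.

Lemma lie_projK (x : lie_quot) : lie_proj (repr x) = x.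
Proof. exact: reprK. Qed.

Lemma lie_projD a b : lie_proj (a + b) = lie_proj a + lie_proj b.
Proof. exact: Quotient.pi_add. Qed.

Lemma lie_proj0 : lie_proj 0 = 0.
Proof. by apply: (addrI (lie_proj 0)); rewrite -lie_projD !addr0. Qed.

Definition lq_scale (k : R) (x : lie_quot) : lie_quot :=
  lie_proj (k *: repr x).
Definition lq_lie (x y : lie_quot) : lie_quot :=
  lie_proj (lie (repr x) (repr y)).

Lemma lq_scaleE k a : lq_scale k (lie_proj a) = lie_proj (k *: a).
Proof.
apply/lie_projP; rewrite -scalerBr.
have [_ _ IZ _] := lie_ideal_genP; apply: IZ.
by apply/lie_projP; rewrite lie_projK.
Qed.

Lemma lieC (a b : L) : lie a b = - lie b a.
Proof.
apply/eqP; rewrite -addr_eq0; apply/eqP.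
by have := liexx (a + b); rewrite lieDl !lieDr !liexx add0r addr0.
Qed.

Lemma lq_lieE a b : lq_lie (lie_proj a) (lie_proj b) = lie_proj (lie a b).
Proof.
have [_ ID IZ IL] := lie_ideal_genP.
set a' := repr (lie_proj a); set b' := repr (lie_proj b).
have Ia : a' - a \in lie_ideal_gen S by apply/lie_projP; rewrite lie_projK.
have Ib : b' - b \in lie_ideal_gen S by apply/lie_projP; rewrite lie_projK.
apply/lie_projP; rewrite -/a' -/b'.
have -> : lie a' b' - lie a b = lie a' (b' - b) + (-1) *: lie b (a' - a).
  rewrite scaleN1r -(lieC (a' - a)) -!scaleN1r lieDl lieDr lieZl lieZr !scaleN1r.
  by rewrite addrA addrNK.
by apply: ID; [apply: IL|apply: IZ; apply: IL].
Qed.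

Lemma lq_ind (P : lie_quot -> Prop) :
  (forall a, P (lie_proj a)) -> forall x, P x.
Proof. by move=> Pa x; rewrite -(lie_projK x). Qed.

Fact lq_scaleA k l x : lq_scale k (lq_scale l x) = lq_scale (k * l) x.
Proof. by elim/lq_ind: x => a; rewrite !lq_scaleE scalerA. Qed.
Fact lq_scale1 : left_id 1 lq_scale.
Proof. by elim/lq_ind=> a; rewrite lq_scaleE scale1r. Qed.
Fact lq_scaleDr : right_distributive lq_scale +%R.
Proof.
move=> k; elim/lq_ind=> a; elim/lq_ind=> b.
by rewrite -lie_projD !lq_scaleE -lie_projD scalerDr.
Qed.
Fact lq_scaleDl x : {morph lq_scale^~ x : k l / k + l}.
Proof.
by move=> k l; elim/lq_ind: x => a; rewrite !lq_scaleE -lie_projD scalerDl.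
Qed.

HB.instance Definition _ := GRing.Zmodule_isLmodule.Build R lie_quot
  lq_scaleA lq_scale1 lq_scaleDr lq_scaleDl.

Lemma lie_projZ k a : lie_proj (k *: a) = k *: lie_proj a.
Proof. by rewrite -lq_scaleE. Qed.

Fact lq_lieDl x y z : lq_lie (x + y) z = lq_lie x z + lq_lie y z.
Proof.
elim/lq_ind: x => a; elim/lq_ind: y => b; elim/lq_ind: z => c.
by rewrite -lie_projD !lq_lieE -lie_projD lieDl.
Qed.
Fact lq_lieDr x y z : lq_lie x (y + z) = lq_lie x y + lq_lie x z.
Proof.
elim/lq_ind: x => a; elim/lq_ind: y => b; elim/lq_ind: z => c.
by rewrite -lie_projD !lq_lieE -lie_projD lieDr.
Qed.
Fact lq_lieZl k x y : lq_lie (k *: x) y = k *: lq_lie x y.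
Proof.
elim/lq_ind: x => a; elim/lq_ind: y => b.
by rewrite -lie_projZ !lq_lieE -lie_projZ lieZl.
Qed.
Fact lq_lieZr k x y : lq_lie x (k *: y) = k *: lq_lie x y.
Proof.
elim/lq_ind: x => a; elim/lq_ind: y => b.
by rewrite -lie_projZ !lq_lieE -lie_projZ lieZr.
Qed.
Fact lq_liexx x : lq_lie x x = 0.
Proof. by elim/lq_ind: x => a; rewrite lq_lieE liexx lie_proj0. Qed.
Fact lq_jacobi x y z :
  lq_lie (lq_lie x y) z + lq_lie (lq_lie y z) x + lq_lie (lq_lie z x) y = 0.
Proof.
elim/lq_ind: x => a; elim/lq_ind: y => b; elim/lq_ind: z => c.
by rewrite !lq_lieE -!lie_projD lie_jacobi lie_proj0.
Qed.

HB.instance Definition _ := Lmodule_isLie.Build R lie_quot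
  lq_lieDl lq_lieDr lq_lieZl lq_lieZr lq_liexx lq_jacobi.

Lemma lie_proj_hom : lie_hom lie_proj.
Proof.
split=> [k a b|a b]; first by rewrite lie_projD lie_projZ.
by rewrite -lq_lieE.
Qed.

End LieQuotient.

(* Bases are families indexed by B: independence forces f to be injective
   on B. *)
Definition is_basis (R : nzRingType) (V : lmodType R) (I : choiceType)
    (B : set I) (f : I -> V) : Prop :=
  (forall (s : seq I) (c : I -> R), uniq s -> (forall i, i \in s -> B i) ->
     \sum_(i <- s) c i *: f i = 0 -> forall i, i \in s -> c i = 0) /\
  (forall v : V, exists (s : seq I) (c : I -> R),
     (forall i, i \in s -> B i) /\ v = \sum_(i <- s) c i *: f i).

(* The generator x_(i+1) is the index i : 'I_n, and a left-normed monomial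
   [x_(i_1), ..., x_(i_m)] is the word i_1 ... i_m. *)
Section PartiallyCommutative.
Variables (R : comNzRingType) (n : nat) (e : rel 'I_n).

Definition edge_relators : set (free_metab R 'I_n) :=
  [set v | exists i j, e i j /\ v = lie (fm_gen R i) (fm_gen R j)]%classic.

Definition pc_metab : lieAlgType R := lie_quot edge_relators.

Definition pc_gen (i : 'I_n) : pc_metab := lie_proj edge_relators (fm_gen R i).

Implicit Types (u v w : seq 'I_n) (d : 'I_n -> nat).

(* The empty word, which is not a monomial, gets the dummy value 0. *)
Definition left_normed w : pc_metab :=
  if w is i :: w' then foldl (fun a j => lie a (pc_gen j)) (pc_gen i) w' else 0.

Definition has_multidegree d w : Prop := forall i, count_mem i w = d i.

(* i and j are vertices of G_u in the same connected component of G_u. *)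
Definition same_component u (i j : 'I_n) : bool :=
  [&& i \in u, j \in u &
      connect [rel x y : 'I_n | [&& x \in u, y \in u & e x y]] i j].

Definition basis' d : set (seq 'I_n) :=
  fun w => has_multidegree d w /\
    exists i1 i2 w', [/\ w = i1 :: i2 :: w', (i2 < i1)%N &
      sorted (fun i j : 'I_n => (i <= j)%N) (i2 :: w')].

Definition basis'' d : set (seq 'I_n) :=
  fun w => basis' d w /\ left_normed w <> 0.

Definition first_equiv u v : Prop :=
  exists i j u' v', [/\ u = i :: u', v = j :: v' & same_component u i j].

Definition first_le u v : Prop :=
  exists i j u' v', [/\ u = i :: u', v = j :: v' & (i <= j)%N].

Definition basis_multidegree d : set (seq 'I_n) :=
  fun w =>
    ((\sum_(i < n) d i = 1)%N /\
       has_multidegree d w /\ exists i, w = [:: i]) \/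
    ((2 <= \sum_(i < n) d i)%N /\ basis'' d w /\
       forall u, basis'' d u -> first_equiv u w -> first_le u w).

Definition pc_basis : set (seq 'I_n) :=
  fun w => exists d, basis_multidegree d w.

End PartiallyCommutative.

(* Main.v *)
From mathcomp Require Import mpoly.
Require Import Defs.
From mathcomp Require Import all_boot all_algebra.
From mathcomp Require Import boolp classical_sets.
From HB Require Import structures.
From mathcomp Require Import zify ring.

(** The theorem is a computation of the multihomogeneous components of
M(X;G), degree by degree. Fix a multidegree of total degree at least 2, given
by a word s, and let S be the set of letters of s. In a metabelian Lie algebra
the letters after the second one in a left-normed monomial can be permuted, so
a monomial of that multidegree is determined by its first two letters i, j:
call it E(i,j) ([pair_word]). The Jacobi identity says exactly that
E(i,k) = E(i,j) + E(j,k) for i, j, k in S ([pair_word_trans]), and an edge ij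
of G gives E(i,j) = 0. So E behaves like a difference f(i) - f(j) of a function
f on S which is constant on the connected components of the graph induced
on S: the component of M(X;G) is the kernel of the augmentation of the free
module on these connected components, and the monomials of the basis are the
f(C) - f(C0), with C0 the connected component of min S and C any other one.

Spanning is the upper bound. Every element is a combination of left-normed
words ([in_span_left_normed]). A word is E(i,j) = E(i,m) - E(j,m) with
m = min S, and E(i,m) depends only on the connected component of i
([pair_word_component]), so that i may be replaced by the largest letter of its
connected component ([in_span_pair_word]).

Independence is the lower bound and needs a model where the f(C) can be told
apart. For a union C of connected components of the graph on S, let x_i act as
the polynomial variable t_i if i is in S, and put t_i = 0 otherwise. In the
Magnus-type Lie algebra on P x P with bracket [(v,p),(w,q)] = (0, w p - v q),
P the polynomial ring, the elements (t_i, 1_C(i) t_i) satisfy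
the relations of G, and a word i j ... goes to (1_C(i) - 1_C(j)) times the
product of its t's ([magnus_ad_word]). Extracting the coefficient of the
monomial of s gives a linear functional on M(X;G) ([component_coef]). Taking
for C the connected component of the first letter of a basis monomial w gives
a functional equal to 1 on w and to 0 on all the others ([pc_basis_dual]). *)

Set Implicit Arguments.
Unset Strict Implicit.
Unset Printing Implicit Defensive.

Import GRing.Theory.
Local Open Scope ring_scope.

(** * Left-normed words in a metabelian Lie algebra *)

Section LeftNormed.
Variables (R : comPzRingType) (L : lieAlgType R).
Hypothesis metabL : metabelian L.
Variables (I : eqType) (x : I -> L).
Implicit Types (a b : L) (s r : seq I) (i j k : I).

Lemma lie0l a : lie 0 a = 0.
Proof. by rewrite -[X in lie X](scale0r 0) lieZl scale0r. Qed.

Definition ad_word a r := foldl (fun b i => lie b (x i)) a r.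

Lemma ad_word0 r : ad_word 0 r = 0.
Proof. by elim: r => //= i r; rewrite lie0l. Qed.

Lemma ad_wordD a b r : ad_word (a + b) r = ad_word a r + ad_word b r.
Proof. by elim: r a b => //= i r IH a b; rewrite lieDl IH. Qed.

Lemma ad_wordN a r : ad_word (- a) r = - ad_word a r.
Proof.
by apply: (addIr (ad_word a r)); rewrite -ad_wordD !addNr ad_word0.
Qed.

(** Jacobi for [a,b], c, d: its third term [[c,d],[a,b]] vanishes in a
metabelian algebra. *)
Lemma lie_lieAC a b c d : lie (lie (lie a b) c) d = lie (lie (lie a b) d) c.
Proof.
have := lie_jacobi (lie a b) c d.
rewrite (lieC (lie c d)) metabL oppr0 addr0 (lieC d) -scaleN1r lieZl scaleN1r.
by move/eqP; rewrite subr_eq0 => /eqP.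
Qed.

Lemma ad_word_rem a b i r : i \in r ->
  ad_word (lie a b) r = ad_word (lie a b) (i :: rem i r).
Proof.
elim: r a b => //= j r IH a b; rewrite inE.
case: (eqVneq j i) => [-> // | ji] /= ir.
by rewrite IH //= lie_lieAC.
Qed.

Lemma perm_ad_word a b r r' : perm_eq r r' ->
  ad_word (lie a b) r = ad_word (lie a b) r'.
Proof.
elim: r r' a b => [|i r IH] r' a b rr'.
  by move: rr'; rewrite perm_sym => /perm_nilP->.
have ir' : i \in r' by rewrite -(perm_mem rr') mem_head.
rewrite (ad_word_rem _ _ ir') /=; apply: IH.
by rewrite -(perm_cons i) (permPl rr'); exact: perm_to_rem.
Qed.

(** The element E(i,j) attached to the multiset of letters s; it is meaningful
for i, j in s (and zero when i = j). *)
Definition pair_word s i j := ad_word (lie (x i) (x j)) (rem j (rem i s)).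

Lemma pair_wordE s i j r : perm_eq s [:: i, j & r] ->
  pair_word s i j = ad_word (lie (x i) (x j)) r.
Proof.
move=> s_ijr; apply: perm_ad_word.
have is_ : i \in s by rewrite (perm_mem s_ijr) mem_head.
have s_jr : perm_eq (rem i s) (j :: r).
  by rewrite -(perm_cons i) -(permPr s_ijr) perm_sym perm_to_rem.
have js : j \in rem i s by rewrite (perm_mem s_jr) mem_head.
by rewrite -(perm_cons j) -(permPr s_jr) perm_sym perm_to_rem.
Qed.

Lemma pair_word_id s i : pair_word s i i = 0.
Proof. by rewrite /pair_word liexx ad_word0. Qed.

Lemma perm_to_rem2 s i j : i != j -> i \in s -> j \in s ->
  perm_eq s [:: i, j & rem j (rem i s)].
Proof.
move=> ij is_ js; rewrite (permPl (perm_to_rem is_)) perm_cons.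
apply: perm_to_rem; move: js.
by rewrite (perm_mem (perm_to_rem is_)) inE eq_sym (negPf ij).
Qed.

Lemma pair_wordC s i j : i \in s -> j \in s ->
  pair_word s j i = - pair_word s i j.
Proof.
case: (eqVneq i j) => [-> | ij] is_ js; first by rewrite pair_word_id oppr0.
have ijs := perm_to_rem2 ij is_ js.
rewrite (pair_wordE ijs) -ad_wordN -lieC; apply: pair_wordE.
by rewrite (permPl ijs); apply/permP=> p /=; lia.
Qed.

(** For distinct i, j, k this is the Jacobi identity for x_i, x_j, x_k, followed
by the action of the remaining letters. *)
Lemma pair_word_trans s i j k : i \in s -> j \in s -> k \in s ->
  pair_word s i k = pair_word s i j + pair_word s j k.
Proof.
move=> is_ js ks.
case: (eqVneq i j) => [->|ij]; first by rewrite pair_word_id add0r.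
case: (eqVneq j k) => [->|jk]; first by rewrite pair_word_id addr0.
case: (eqVneq i k) => [->|ik].
  by rewrite [in X in _ + X]pair_wordC // pair_word_id subrr.
have ijs := perm_to_rem2 ij is_ js.
have kr : k \in rem j (rem i s).
  by move: ks; rewrite (perm_mem ijs) !inE eq_sym (negPf ik) eq_sym (negPf jk).
have := perm_to_rem kr; set r := rem k _ => krE.
have s_ijk : perm_eq s [:: i, j, k & r].
  by rewrite (permPl ijs) !perm_cons.
rewrite -[LHS]opprK -pair_wordC // (pair_wordE s_ijk).
rewrite (@pair_wordE s j k (i :: r)); last first.
  by rewrite (permPl s_ijk); apply/permP=> p /=; lia.
rewrite (@pair_wordE s k i (j :: r)) /=; last first.
  by rewrite (permPl s_ijk); apply/permP=> p /=; lia.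
apply/eqP; rewrite eq_sym -subr_eq0 opprK -!ad_wordD.
by rewrite lie_jacobi ad_word0.
Qed.

End LeftNormed.

(** * Spans and dual families *)

Section Span.
Variables (R : nzRingType) (V : lmodType R) (I : choiceType).
Variables (B : set I) (f : I -> V).

(** Coefficients are attached to positions of the list, not to indices, so that
sums are mere concatenations; [in_spanP] regroups equal indices. *)
Definition in_span (v : V) :=
  exists2 l : seq (R * I), forall p, p \in l -> B p.2 &
    v = \sum_(p <- l) p.1 *: f p.2.

Lemma in_span0 : in_span 0.
Proof. by exists [::]; rewrite ?big_nil. Qed.

Lemma in_spanD u v : in_span u -> in_span v -> in_span (u + v).
Proof.
move=> [l lB ->] [m mB ->]; exists (l ++ m); last by rewrite big_cat.
by move=> p; rewrite mem_cat => /orP[/lB|/mB].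
Qed.

Lemma in_spanZ k v : in_span v -> in_span (k *: v).
Proof.
move=> [l lB ->]; exists [seq (k * p.1, p.2) | p <- l].
  by move=> p /mapP[q /lB qB ->].
by rewrite big_map scaler_sumr; apply: eq_bigr => p _; rewrite scalerA.
Qed.

Lemma in_spanN v : in_span v -> in_span (- v).
Proof. by rewrite -scaleN1r; exact: in_spanZ. Qed.

Lemma in_span_gen i : B i -> in_span (f i).
Proof.
move=> Bi; exists [:: (1, i)]; last by rewrite big_seq1 scale1r.
by move=> p; rewrite inE => /eqP->.
Qed.

Lemma in_span_ind (Q : V -> Prop) : Q 0 ->
  (forall k i v, B i -> Q v -> Q (k *: f i + v)) ->
  forall v, in_span v -> Q v.
Proof.
move=> Q0 QD v [l lB ->]; elim: l lB => [|p l IH] lB; first by rewrite big_nil.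
rewrite big_cons; apply: QD; first by apply: lB; rewrite mem_head.
by apply: IH => q ql; apply: lB; rewrite inE ql orbT.
Qed.

Lemma in_spanP v : in_span v ->
  exists (s : seq I) (c : I -> R),
    (forall i, i \in s -> B i) /\ v = \sum_(i <- s) c i *: f i.
Proof.
move=> [l lB ->]; exists (undup (map snd l)).
exists (fun i => \sum_(p <- l | p.2 == i) p.1); split.
  by move=> i; rewrite mem_undup => /mapP[p /lB pB ->].
under [RHS]eq_bigr => i _ do rewrite scaler_suml.
rewrite (exchange_big_dep predT) //= [LHS]big_seq [RHS]big_seq.
apply: eq_bigr => p pl; rewrite -big_filter.
have -> : [seq i <- undup (map snd l) | p.2 == i] = [:: p.2].
  rewrite (eq_filter (a2 := pred1 p.2)) => [|i]; last exact: eq_sym.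
  by rewrite filter_pred1_uniq ?undup_uniq // mem_undup map_f.
by rewrite big_seq1.
Qed.

End Span.

Lemma dual_family_indep (R : nzRingType) (V : lmodType R) (I : choiceType)
    (B : set I) (f : I -> V) :
  (forall i, B i -> exists2 phi : V -> R, linear_for *%R phi &
     phi (f i) = 1 /\ forall j, B j -> j != i -> phi (f j) = 0) ->
  forall (s : seq I) (c : I -> R), uniq s -> (forall i, i \in s -> B i) ->
    \sum_(i <- s) c i *: f i = 0 -> forall i, i \in s -> c i = 0.
Proof.
move=> dual s c us sB sum0 i is_.
have [phi phil [phi1 phi0]] := dual i (sB i is_).
have phi00 : phi 0 = 0.
  have := phil 1 0 0; rewrite scale1r mul1r addr0.
  by move/(congr1 (fun a => a - phi 0)); rewrite addrK subrr => <-.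
have phi_sum r : phi (\sum_(j <- r) c j *: f j) = \sum_(j <- r) c j * phi (f j).
  by elim: r => [|j r IH]; rewrite ?big_nil ?big_cons // phil IH.
have := congr1 phi sum0; rewrite phi_sum phi00 (bigD1_seq i) //= phi1 mulr1.
rewrite big1_seq ?addr0 // => j /andP[ji js].
by rewrite phi0 ?mulr0 //; exact: sB.
Qed.

(** * A Lie algebra of Magnus type *)

Section Magnus.
Variables (R : comPzRingType) (P : comAlgType R).

(** The semidirect product of the abelian Lie algebra P with the P-module P,
acted upon by multiplication. *)
Definition magnus : Type := (P * P)%type.
HB.instance Definition _ := GRing.Lmodule.on magnus.

Definition magnus_lie (a b : magnus) : magnus :=
  (0, b.1 * a.2 - a.1 * b.2).

Fact magnus_lieDl a b c :
  magnus_lie (a + b) c = magnus_lie a c + magnus_lie b c.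
Proof. by congr pair; rewrite /= ?addr0 //; ring. Qed.
Fact magnus_lieDr a b c :
  magnus_lie a (b + c) = magnus_lie a b + magnus_lie a c.
Proof. by congr pair; rewrite /= ?addr0 //; ring. Qed.
Fact magnus_lieZl k a b : magnus_lie (k *: a) b = k *: magnus_lie a b.
Proof.
by congr pair; rewrite /= ?scaler0 // scalerBr -scalerAr -scalerAl.
Qed.
Fact magnus_lieZr k a b : magnus_lie a (k *: b) = k *: magnus_lie a b.
Proof.
by congr pair; rewrite /= ?scaler0 // scalerBr -scalerAr -scalerAl.
Qed.
Fact magnus_liexx a : magnus_lie a a = 0.
Proof. by congr pair; rewrite /= subrr. Qed.
Fact magnus_jacobi a b c :
  magnus_lie (magnus_lie a b) c + magnus_lie (magnus_lie b c) a +
  magnus_lie (magnus_lie c a) b = 0.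
Proof. by congr pair; rewrite /= ?addr0 //; ring. Qed.

HB.instance Definition _ := Lmodule_isLie.Build R magnus
  magnus_lieDl magnus_lieDr magnus_lieZl magnus_lieZr
  magnus_liexx magnus_jacobi.

Lemma magnus_metabelian : metabelian magnus.
Proof. by move=> a b c d; congr pair; rewrite /= !mul0r subr0. Qed.

(** A derived element (0,p) is bracketed with (t,_) by multiplying p with t,
so only the initial bracket sees the function c. *)
Lemma magnus_ad_word (I : eqType) (t c : I -> P) i j r :
  ad_word (fun k => (t k, c k * t k) : magnus)
    (lie ((t i, c i * t i) : magnus) ((t j, c j * t j) : magnus)) r =
  (0, (c i - c j) * \prod_(k <- [:: i, j & r]) t k).
Proof.
have E p : ad_word (fun k => (t k, c k * t k) : magnus) ((0, p) : magnus) r =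
    (0, p * \prod_(k <- r) t k).
  elim: r p => [|k r IH] p; first by rewrite big_nil mulr1.
  rewrite big_cons mulrA /= -IH; congr ad_word; congr pair => /=.
  by rewrite mul0r subr0 mulrC.
rewrite -[lie _ _]/((0, t j * (c i * t i) - t i * (c j * t j)) : magnus) E.
by congr pair; rewrite !big_cons; ring.
Qed.

End Magnus.

(** * The partially commutative metabelian Lie algebra *)

Lemma lie_hom0 (R : comPzRingType) (L L' : lieAlgType R) (g : L -> L') :
  lie_hom g -> g 0 = 0.
Proof.
move=> [gl _]; have := gl 1 0 0; rewrite !scale1r addr0.
by move/(congr1 (fun a => a - g 0)); rewrite addrK subrr => <-.
Qed.

Lemma foldl_lie_hom (R : comPzRingType) (L L' : lieAlgType R) (g : L -> L')
    (I : eqType) (x : I -> L) a r : lie_hom g ->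
  g (ad_word x a r) = ad_word (g \o x) (g a) r.
Proof. by move=> [_ gm]; elim: r a => //= i r IH a; rewrite IH gm. Qed.

Section PartiallyCommutative.
Variables (R : comNzRingType) (n : nat) (e : rel 'I_n).

Let M := pc_metab R e.
Let g : 'I_n -> M := pc_gen R e.

Lemma pc_metab_metabelian : metabelian M.
Proof.
move=> a b c d; rewrite -[a]lie_projK -[b]lie_projK -[c]lie_projK -[d]lie_projK.
have [_ pm] := lie_proj_hom (@edge_relators R n e).
by rewrite -!pm free_metabP lie_proj0.
Qed.

Lemma pc_gen_edge i j : e i j -> lie (g i) (g j) = 0.
Proof.
move=> eij; have [_ pm] := lie_proj_hom (@edge_relators R n e).
rewrite -pm -(lie_proj0 (@edge_relators R n e)); apply/lie_projP; rewrite subr0.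
by apply: sub_lie_ideal_gen; exists i, j.
Qed.

Lemma pc_metab_lift (L : lieAlgType R) (f : 'I_n -> L) : metabelian L ->
  (forall i j, e i j -> lie (f i) (f j) = 0) ->
  exists2 h : M -> L, lie_hom h & forall i, h (g i) = f i.
Proof.
move=> metabL fe; have [h [hl hm] hf] := free_metab_lift f metabL.
have h0 : h 0 = 0 by apply: lie_hom0.
have hI v : v \in lie_ideal_gen (@edge_relators R n e) -> h v = 0.
  move=> /asboolP/(_ [set v | h v = 0]%classic); apply.
    split=> //= [a b ha hb|k a ha|a b hb].
    - by rewrite -[a]scale1r hl ha hb scaler0 addr0.
    - by rewrite -[k *: a]addr0 hl ha h0 scaler0 addr0.
    - by rewrite hm hb lieC lie0l oppr0.
  by move=> _ /= [i [j [eij ->]]]; rewrite hm !hf fe.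
pose k (a : M) : L := h (repr a).
have kE v : k (lie_proj (@edge_relators R n e) v) = h v.
  have /hI : repr (lie_proj (@edge_relators R n e) v) - v \in
      lie_ideal_gen (@edge_relators R n e) by apply/lie_projP; rewrite lie_projK.
  rewrite addrC -scaleN1r hl scaleN1r => /eqP.
  by rewrite addrC subr_eq0 => /eqP.
have [pl pm] := lie_proj_hom (@edge_relators R n e).
exists k => [|i]; last by rewrite -hf -kE.
split=> [r a b|a b]; elim/lq_ind: a => a; elim/lq_ind: b => b.
  by rewrite -pl !kE hl.
by rewrite -pm !kE hm.
Qed.

Lemma left_normed_lie_derived i j r :
  exists a b, left_normed R e [:: i, j & r] = lie a b.
Proof.
case/lastP: r => [|r k]; first by exists (g i), (g j).
by exists (left_normed R e [:: i, j & r]), (g k); rewrite /= foldl_rcons.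
Qed.

(** The span of the left-normed words contains the generators and is closed
under the bracket: two words of length at least 2 have bracket zero, and
bracketing with a generator appends a letter. *)
Lemma in_span_left_normed (a : M) :
  in_span [set: seq 'I_n] (left_normed R e) a.
Proof.
set T := in_span _ _.
have Tln w : T (left_normed R e w) by apply: in_span_gen.
have T0 : T 0 by apply: in_span0.
have TN b : T b -> T (- b) by apply: in_spanN.
have Tlie_gen b i : T b -> T (lie b (g i)).
  move=> Tb; elim/in_span_ind: Tb => [|k w {}b _ IH]; first by rewrite lie0l.
  rewrite lieDl lieZl; apply: in_spanD => //; apply: in_spanZ.
  case: w => [|j w]; first by rewrite lie0l.
  have -> : lie (left_normed R e (j :: w)) (g i) =
      left_normed R e (rcons (j :: w) i) by rewrite /= foldl_rcons.
  exact: Tln.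
have Tlie_ln w v : T (lie (left_normed R e w) (left_normed R e v)).
  case: v => [|j [|k v]].
  - by rewrite lieC lie0l oppr0.
  - exact: Tlie_gen.
  - case: w => [|i [|l w]]; first by rewrite lie0l.
      by rewrite lieC; apply/TN/Tlie_gen.
    have [a1 [a2 ->]] := left_normed_lie_derived i l w.
    have [b1 [b2 ->]] := left_normed_lie_derived j k v.
    by rewrite pc_metab_metabelian.
have Tlie b c : T b -> T c -> T (lie b c).
  move=> Tb Tc; elim/in_span_ind: Tb => [|k w {}b _ Tbc]; first by rewrite lie0l.
  rewrite lieDl lieZl; apply: in_spanD => //; apply: in_spanZ => {b Tbc}.
  elim/in_span_ind: Tc => [|l v c' _ Tc'].
    by rewrite lieC lie0l oppr0.
  by rewrite lieDr lieZr; apply: in_spanD => //; apply: in_spanZ; exact: Tlie_ln.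
have [pl pm] := lie_proj_hom (@edge_relators R n e).
elim/lq_ind: a => a; elim/fm_ind: a; elim=> [i||t IH|t IHt u IHu|k t IH|t IHt u IHu].
- exact: (Tln [:: i]).
- by rewrite fm_class0 lie_proj0.
- by rewrite fm_classN -scaleN1r lie_projZ scaleN1r; exact: TN.
- by rewrite fm_classD lie_projD; exact: in_spanD.
- by rewrite fm_classZ lie_projZ; exact: in_spanZ.
- by rewrite fm_classL pm; exact: Tlie.
Qed.

Definition mon (w : seq 'I_n) : 'X_{1..n} := (\sum_(i <- w) U_(i))%MM.

Lemma monE w i : mon w i = count_mem i w.
Proof.
rewrite /mon mnm_sumE -sum1_count [RHS]big_mkcond /=.
by apply: eq_bigr => j _; rewrite mnm1E; case: eqP.
Qed.

Lemma mon_eq w v : (mon w == mon v) = perm_eq w v.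
Proof.
apply/eqP/idP => [wv|/permP wv]; last by apply/mnmP=> i; rewrite !monE wv.
by apply/allP=> i _ /=; rewrite -!monE wv.
Qed.

(** The variables outside v are killed, so that an edge with an endpoint
outside v imposes no condition on the function C of [component_coef]. *)
Definition supp_var (v : seq 'I_n) (i : 'I_n) : {mpoly R[n]} :=
  if i \in v then 'X_i else 0.

Lemma coef_supp_var v w :
  (\prod_(i <- w) supp_var v i)@_(mon v) = (perm_eq w v)%:R.
Proof.
case: (boolP (all (mem v) w)) => [/allP wv|/allPn[i iw iv]].
  rewrite (eq_big_seq (fun i => 'X_i)) => [|i /wv /= iv].
    rewrite -(big_map (fun i => U_(i)%MM) predT (fun m => 'X_[m])).
    by rewrite mpolyX_prod big_map mcoeffX mon_eq.
  by rewrite /supp_var iv.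
rewrite (big_rem i) //= /supp_var (negPf (iv : i \notin v)) mul0r mcoeff0.
case: (boolP (perm_eq w v)) => // /perm_mem wv.
by case/negP: (iv : i \notin v); rewrite -wv.
Qed.

(** The functional is the coefficient of the monomial of v in the second
component of the image under x_i |-> (t_i, C(i) t_i). An edge ij inside v
goes to (C(i) - C(j)) t_i t_j = 0. *)
Lemma component_coef (v : seq 'I_n) (C : pred 'I_n) :
  (forall i j, i \in v -> j \in v -> e i j -> C i = C j) ->
  exists2 phi : M -> R, linear_for *%R phi &
    (forall i, phi (left_normed R e [:: i]) = (C i && perm_eq [:: i] v)%:R) /\
    (forall i j r, phi (left_normed R e [:: i, j & r]) =
       ((C i)%:R - (C j)%:R) * (perm_eq [:: i, j & r] v)%:R).
Proof.
move=> Ce; pose t := supp_var v; pose c i : {mpoly R[n]} := (C i)%:R.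
pose f i : magnus {mpoly R[n]} := (t i, c i * t i).
have [||h [hl hm] hf] := @pc_metab_lift (magnus {mpoly R[n]}) f.
- exact: magnus_metabelian.
- move=> i j eij; congr pair => /=; rewrite /t /supp_var.
  case: ifP => jv; case: ifP => iv; rewrite ?mulr0 ?mul0r ?subr0 //.
  by rewrite /c (Ce _ _ iv jv eij); ring.
exists (fun a => (h a).2@_(mon v)) => [k a b|]; first by rewrite hl mcoeffD mcoeffZ.
have cE i p : (c i * p)@_(mon v) = (C i)%:R * p@_(mon v).
  by rewrite /c; case: (C i); rewrite ?mul1r ?mul0r ?mcoeff0.
split=> [i|i j r].
  have -> : left_normed R e [:: i] = g i by [].
  rewrite hf /= cE -[t i](big_seq1 *%R) coef_supp_var.
  by case: (C i); rewrite ?mul1r ?mul0r.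
have -> : left_normed R e [:: i, j & r] = ad_word g (lie (g i) (g j)) r by [].
rewrite (foldl_lie_hom _ _ _ (conj hl hm)) hm !hf.
have -> : ad_word (h \o g) (lie (f i) (f j)) r = ad_word f (lie (f i) (f j)) r.
  by rewrite /ad_word; elim: r (lie _ _) => //= k r IH a; rewrite hf IH.
rewrite magnus_ad_word /= mulrBl mcoeffB !cE coef_supp_var -mulrBl.
done.
Qed.

End PartiallyCommutative.

(** * Connected components and the basis *)

Section Components.
Variables (R : comNzRingType) (n : nat) (e : rel 'I_n).
Hypothesis e_sym : symmetric e.
Implicit Types (s u v w : seq 'I_n) (i j k m : 'I_n).

Let ln := left_normed R e.
Let pw := pair_word (pc_gen R e).

Lemma pwE s i j r : perm_eq s [:: i, j & r] -> pw s i j = ln [:: i, j & r].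
Proof. exact/pair_wordE/(@pc_metab_metabelian R n e). Qed.

Lemma pw_trans s i j k : i \in s -> j \in s -> k \in s ->
  pw s i k = pw s i j + pw s j k.
Proof. exact/pair_word_trans/(@pc_metab_metabelian R n e). Qed.

Lemma pwC s i j : i \in s -> j \in s -> pw s j i = - pw s i j.
Proof. exact/pair_wordC/(@pc_metab_metabelian R n e). Qed.

Lemma sum_count_mem s : (\sum_(i < n) count_mem i s = size s)%N.
Proof.
elim: s => [|k s IH] /=; first exact: big1.
rewrite big_split /= IH (bigD1 k) //= eqxx big1 // => i /negPf.
by rewrite eq_sym => ->.
Qed.

Lemma same_component_sym s i j : same_component e s i j = same_component e s j i.
Proof.
rewrite /same_component andbCA; congr [&& _, _ & _].
by apply: sym_connect_sym => a b /=; rewrite andbCA e_sym.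
Qed.

Lemma same_component_trans s i j k :
  same_component e s i j -> same_component e s j k -> same_component e s i k.
Proof.
case/and3P=> is_ _ ij /and3P[_ ks jk]; rewrite /same_component is_ ks /=.
exact: connect_trans ij jk.
Qed.

Lemma same_component_refl s i : i \in s -> same_component e s i i.
Proof. by move=> is_; rewrite /same_component is_ connect0. Qed.

Lemma eq_same_component s u i j : s =i u ->
  same_component e s i j = same_component e u i j.
Proof.
move=> su; rewrite /same_component !su; congr [&& _, _ & _].
by apply: eq_connect => a b /=; rewrite !su.
Qed.

Lemma same_component_edge s i j : i \in s -> j \in s -> e i j ->
  same_component e s i j.
Proof.
by move=> is_ js eij; rewrite /same_component is_ js connect1 //= is_ js.
Qed.

(** E(i,j) = 0 is a transitive relation on the letters of s which holds along
edges, hence along paths. *)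
Lemma pair_word_component s i j : same_component e s i j -> pw s i j = 0.
Proof.
case/and3P=> is_ js /connectP[p]; elim: p i is_ => [|k p IH] i is_ /=.
  by move=> _ ->; rewrite /pw pair_word_id.
case/andP=> /and3P[_ ks eik] kp jE.
rewrite (@pw_trans s i k j) // (IH k) // addr0.
by rewrite /pw /pair_word pc_gen_edge ?ad_word0.
Qed.

Definition ord_leq : rel 'I_n := fun i j => (i <= j)%N.

Lemma ord_leq_trans : transitive ord_leq. Proof. by move=> j i k; apply: leq_trans. Qed.
Lemma ord_leq_total : total ord_leq. Proof. by move=> i j; apply: leq_total. Qed.
Lemma ord_leq_anti : antisymmetric ord_leq.
Proof. by move=> i j ij; apply/val_inj/anti_leq. Qed.

Lemma sorted_head_min m r k : sorted ord_leq (m :: r) -> k \in m :: r -> (m <= k)%N.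
Proof.
move=> /= /(order_path_min ord_leq_trans)/allP mr; rewrite inE.
by case/predU1P=> [-> //|/mr].
Qed.

(** A basis monomial does not vanish, so by [pair_word_component] its first two
letters lie in distinct connected components. *)
Lemma pc_basisP w : pc_basis R e w ->
  (exists i, w = [:: i]) \/
  exists i j r, [/\ w = [:: i, j & r], (j < i)%N, sorted ord_leq (j :: r),
    ~~ same_component e w i j &
    forall u, pc_basis R e u -> perm_eq u w -> first_equiv e u w ->
      first_le u w].
Proof.
move=> [d [[_ [_ wi]]|[_ [[[dw [i [j [r [wE ji jr]]]] w0] wmax]]]]]; first by left.
right; exists i, j, r; split=> //.
  apply/negP=> /pair_word_component; rewrite wE.
  by rewrite (@pwE _ i j r) // => lnw0; apply: w0; rewrite wE.
move=> u [d' [[_ [_ [k ->]]]|[_ [[[_ uE] u0] _]]]] uw.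
  by have := perm_size uw; rewrite wE.
by apply: wmax; split=> //; split=> // k; rewrite -dw; apply/permP.
Qed.

(** The second letter is the smallest one, and the tail is sorted: the first
letter and the multidegree determine the monomial. *)
Lemma pc_basis_perm_inj i j r k (l : 'I_n) (t : seq 'I_n) :
  (j < i)%N -> sorted ord_leq (j :: r) -> (l < k)%N -> sorted ord_leq (l :: t) ->
  perm_eq [:: k, l & t] [:: i, j & r] ->
  l = j /\ (k = i -> [:: k, l & t] = [:: i, j & r]).
Proof.
have min_hd (a b c : 'I_n) q : (b < a)%N -> sorted ord_leq (b :: q) ->
    c \in [:: a, b & q] -> (b <= c)%N.
  move=> ba bq; rewrite inE => /predU1P[->|]; first exact: ltnW.
  exact: sorted_head_min.
move=> ji jr lk lt ut; split.
  apply/val_inj/anti_leq; rewrite (min_hd _ _ _ _ lk lt) ?(perm_mem ut) ?inE ?eqxx ?orbT //.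
  by rewrite (min_hd _ _ _ _ ji jr) // -(perm_mem ut) !inE eqxx orbT.
move=> ki; rewrite {}ki perm_cons in ut *.
by rewrite (sorted_eq ord_leq_trans ord_leq_anti lt jr ut).
Qed.

(** On a basis monomial u of the same multidegree as w, the second letter is
again min S, where the functional for the connected component C of the first
letter of w sees 0; it sees 1 at the first letter of u only if that letter
lies in C, and then both first letters are the largest of C. *)
Lemma pc_basis_dual w : pc_basis R e w ->
  exists2 phi : pc_metab R e -> R, linear_for *%R phi &
    phi (ln w) = 1 /\ forall u, pc_basis R e u -> u != w -> phi (ln u) = 0.
Proof.
move=> Bw; have [[i wE]|[i [j [r [wE ji jr ij wmax]]]]] := pc_basisP Bw.
  (* A generator is its own connected component. *)
  have [|phi phil [phi1 phi2]] := @component_coef R n e w (pred1 i).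
    by move=> a b; rewrite wE !inE => /eqP-> /eqP->.
  exists phi => //; split=> [|u /pc_basisP[[k ->]|[k [l [t [-> _ _ _ _]]]]] uw].
  - by rewrite wE phi1 wE /= eqxx perm_refl.
  - rewrite phi1 /=; case: eqP => //= ki.
    by rewrite ki wE eqxx in uw.
  - rewrite phi2; case: (boolP (perm_eq _ _)) => [/perm_size|]; last by rewrite mulr0.
    by rewrite wE.
have iw : i \in w by rewrite wE mem_head.
have [|phi phil [phi1 phi2]] := @component_coef R n e w (same_component e w i).
  move=> a b aw bw eab; apply/idP/idP => [ia|ib].
    exact: same_component_trans ia (same_component_edge aw bw eab).
  apply: same_component_trans ib _; rewrite same_component_sym.
  exact: same_component_edge.
exists phi => //; split=> [|u Bu uw].
  rewrite wE /ln phi2 -wE same_component_refl // (negPf ij) perm_refl.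
  by rewrite subr0 mulr1.
have [[k uE]|[k [l [t [uE lk lt kl umax]]]]] := pc_basisP Bu.
  rewrite uE /ln phi1 [perm_eq _ _](_ : _ = false) ?andbF //.
  by apply/negP=> /perm_size; rewrite wE.
rewrite uE /ln phi2 -uE.
case: (boolP (perm_eq u w)) => [puw|]; last by rewrite mulr0.
have [lj kiE] : l = j /\ (k = i -> u = w).
  by rewrite uE wE; apply: pc_basis_perm_inj; rewrite // -uE -wE.
rewrite lj (negPf ij).
case: (boolP (same_component e w i k)) => [ik|]; last by rewrite subrr mul0r.
case/negP: uw; apply/eqP/kiE.
have [|k1 [i1 [u1 [w1 [uE1 wE1 ki]]]]] := wmax u Bu puw.
  exists k, i, (l :: t), (j :: r); split=> //.
  by rewrite (eq_same_component _ _ (perm_mem puw)) same_component_sym.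
have [||i2 [k2 [w2 [u2 [wE2 uE2 ik2]]]]] := umax w Bw; first by rewrite perm_sym.
  exists i, k, (j :: r), (l :: t); split=> //.
move: uE1 wE1 wE2 uE2 ki ik2; rewrite uE wE.
by move=> [<- _] [<- _] [<- _] [<- _] ki ik2; apply/val_inj/anti_leq/andP.
Qed.

(** If E(i,m) is nonzero, it equals E(k,m) for k the largest letter in the
connected component of i, and this is a monomial of the basis once its tail is
sorted. *)
Lemma in_span_pair_word s i m : i \in s -> m \in s ->
  (forall k, k \in s -> (m <= k)%N) ->
  in_span (pc_basis R e) ln (pw s i m).
Proof.
move=> is_ ms mmin; have [->|pw0] := EM (pw s i m = 0); first exact: in_span0.
case: (@arg_maxnP _ i (same_component e s i) val (same_component_refl is_)).
move=> k ik kmax; have ks : k \in s by case/and3P: ik.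
have pwk : pw s i m = pw s k m.
  by rewrite (@pw_trans s i k m) // pair_word_component ?add0r.
have km : k != m.
  by apply/eqP=> km; apply: pw0; rewrite pwk km /pw pair_word_id.
have [r mr rE] : exists2 r, sorted ord_leq (m :: r) & perm_eq s [:: k, m & r].
  have kmr := perm_to_rem2 km ks ms; pose r := sort ord_leq (rem m (rem k s)).
  exists r => /=; last by rewrite (permPl kmr) !perm_cons perm_sym perm_sort.
  rewrite (path_sortedE ord_leq_trans) (sort_sorted ord_leq_total) andbT.
  apply/allP=> a; rewrite mem_sort => ar; apply: mmin.
  by rewrite (perm_mem kmr) !inE ar !orbT.
have lnE : ln [:: k, m & r] = pw s k m by rewrite (pwE rE).
rewrite pwk -lnE; apply: in_span_gen.
exists (fun a => count_mem a s); right; split.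
  by rewrite sum_count_mem (perm_size rE).
split.
  split; last by rewrite -/ln lnE -pwk.
  split; first by move=> a; apply/permP; rewrite perm_sym.
  exists k, m, r; split=> //; rewrite ltn_neqAle mmin // andbT.
  by apply: contraNneq km => mk; rewrite eq_sym; apply/eqP/val_inj.
move=> u [[us _] _] [a [b [u' [v' [uE vE ab]]]]].
exists a, b, u', v'; split=> //.
have bE : b = k by case: vE.
rewrite {}bE in ab *; suff /kmax : same_component e s i a by [].
apply: same_component_trans ik _; rewrite same_component_sym.
rewrite (@eq_same_component s u) // => c.
by rewrite -!has_pred1 !has_count us.
Qed.

Lemma in_span_pc_basis (a : pc_metab R e) : in_span (pc_basis R e) ln a.
Proof.
have := in_span_left_normed a; elim/in_span_ind.
  exact: in_span0.
move=> k w {}a _; apply: in_spanD; apply: in_spanZ.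
case: w => [|i [|j w]]; first exact: in_span0.
  apply: in_span_gen; exists (fun k => count_mem k [:: i]); left; split.
    exact: sum_count_mem.
  by split=> //; exists i.
set s := [:: i, j & w].
have is_ : i \in s by rewrite mem_head.
have js : j \in s by rewrite !inE eqxx orbT.
have -> : left_normed R e s = pw s i j.
  by rewrite (@pwE s i j w).
case: (@arg_minnP _ i (mem s) val is_) => m ms mmin.
rewrite (@pw_trans s i m j) // (@pwC s j m) //.
by apply: in_spanD; last apply: in_spanN; exact: in_span_pair_word.
Qed.

End Components.

Theorem theorem3p3 (R : comNzRingType) (n : nat) (e : rel 'I_n)
    (e_sym : symmetric e) (e_irr : irreflexive e) :
  is_basis (pc_basis R e) (left_normed R e).
Proof.
split; first exact/dual_family_indep/pc_basis_dual.
by move=> a; exact/in_spanP/in_span_pc_basis.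
Qed.
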